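(* Let $S$ be a semidomain. Then the following statements are equivalent: (1) The semiring $S$ is a Prüfer semiring. (2) $I(J\cap K)=IJ\cap IK$ for all ideals $I$, $J$, and $K$ of $S$. (3) $(I+J)(I\cap J)=IJ$ for all ideals $I$ and $J$ of $S$. (4) $[(I+J):K]=[I:K]+[J:K]$ for all ideals $I$, $J$, and $K$ of $S$ with $K$ finitely generated. (5) $[I:J]+[J:I]=S$ for all finitely generated ideals $I$ and $J$ of $S$. (6) $[K:I\cap J]=[K:I]+[K:J]$ for all ideals $I$, $J$, and $K$ of $S$ with $I$ and $J$ finitely generated.
   Context: A semiring is a set $S$ with operations $+,\cdot$ such that $(S,+)$ is a commutative monoid with identity $0$, $(S,\cdot)$ is a commutative monoid with identity $1\neq 0$, multiplication distributes over addition, and $s\cdot 0=0$ for all $s\in S$. An ideal of $S$ is a nonempty subset $I\subseteq S$ such that $a,b\in I$ and $s\in S$ imply $a+b, sa\in I$. For ideals $I,J$ of $S$: $I+J=\{a+b: a\in I, b\in J\}$, $IJ$ is the set of finite sums $\sum a_ib_i$ with $a_i\in I$, $b_i\in J$, and $[I:J]=\{s\in S: sJ\subseteq I\}$. An element $s\in S$ is multiplicatively cancellable (MC) if $sb=sc$ implies $b=c$ for all $b,c\in S$; $S$ is a semidomain if every nonzero element of $S$ is MC. The total quotient semiring $Q(S)$ is the localization of $S$ at the set $M$ of its MC elements: the set of classes $a/b$ of pairs $(a,b)\in S\times M$ under $(a,b)\sim(c,d)$ iff $tad=tbc$ for some $t\in M$, with $a/b+c/d=(ad+bc)/(bd)$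 and $(a/b)(c/d)=(ac)/(bd)$; $S$ is viewed inside $Q(S)$ via $s\mapsto s/1$. A fractional ideal of $S$ is a nonempty subset $I\subseteq Q(S)$ closed under addition and under multiplication by elements of $S$, such that $dI\subseteq S$ for some MC element $d\in S$. The product of fractional ideals is $IJ=\{a_1b_1+\cdots+a_nb_n: a_i\in I,\ b_i\in J\}$. A fractional ideal (in particular an ideal) $I$ of $S$ is invertible if $IJ=S$ for some fractional ideal $J$ of $S$. A semiring $S$ is a Prüfer semiring if every nonzero finitely generated ideal of $S$ is invertible. *)

(* Defs.v *)
From HB Require Import structures.
From mathcomp Require Import all_boot all_algebra.
From mathcomp Require Import boolp classical_sets cardinality.
From mathcomp Require Import ring.

Set Implicit Arguments.
Unset Strict Implicit.
Unset Printing Implicit Defensive.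

Import GRing.Theory.
Local Open Scope ring_scope.
Local Open Scope quotient_scope.
Local Open Scope classical_set_scope.

(* The total quotient semiring Q(S).  [GRing.lreg s] is the cancellation      *)
(* property [injective ( *%R s)], that is, s is an MC element.                *)
Section TotalQuotient.
Variable S : comNzSemiRingType.
Implicit Types s t : S.

Definition mc : Type := {s : S | `[< GRing.lreg s >]}.

Lemma mcP (b : mc) : GRing.lreg (sval b).
Proof. exact/asboolP/(valP b). Qed.

Lemma mc1_subproof : `[< GRing.lreg (1 : S) >].
Proof. exact/asboolP/lreg1. Qed.
Definition mc1 : mc := exist (fun s => `[< GRing.lreg s >]) 1 mc1_subproof.

Lemma mcM_subproof (b d : mc) : `[< GRing.lreg (sval b * sval d) >].
Proof. by apply/asboolP/lregM; exact: mcP. Qed.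
Definition mcM (b d : mc) : mc :=
  exist (fun s => `[< GRing.lreg s >]) (sval b * sval d) (mcM_subproof b d).

Definition prefrac : Type := (S * mc)%type.
Implicit Types x y z : prefrac.

Definition frac_rel x y : bool :=
  `[< exists2 t, GRing.lreg t & t * x.1 * sval y.2 = t * sval x.2 * y.1 >].

Lemma frac_rel_refl : reflexive frac_rel.
Proof.
by move=> x; apply/asboolP; exists 1; [exact: lreg1 | rewrite !mul1r mulrC].
Qed.

Lemma frac_rel_sym : symmetric frac_rel.
Proof.
suff h x y : frac_rel x y -> frac_rel y x by move=> x y; apply/idP/idP; exact: h.
move=> /asboolP[t tP e]; apply/asboolP; exists t => //.
by rewrite -!mulrA [y.1 * _]mulrC [sval y.2 * _]mulrC !mulrA e.
Qed.

Lemma frac_rel_trans : transitive frac_rel.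
Proof.
move=> y x z /asboolP[t tP e1] /asboolP[u uP e2]; apply/asboolP.
exists (t * u * sval y.2); first by apply/lregM; [exact: lregM|exact: mcP].
transitivity (t * x.1 * sval y.2 * (u * sval z.2)); first by ring.
rewrite e1.
transitivity (t * sval x.2 * (u * y.1 * sval z.2)); first by ring.
by rewrite e2; ring.
Qed.

Canonical frac_equiv :=
  EquivRel frac_rel frac_rel_refl frac_rel_sym frac_rel_trans.

Definition total_quotient : Type := {eq_quot frac_rel}.
HB.instance Definition _ : EqQuotient _ frac_rel total_quotient :=
  EqQuotient.on total_quotient.
HB.instance Definition _ := Choice.on total_quotient.

Lemma repr_frac_rel x : frac_rel x (repr (\pi_total_quotient x)).
Proof. by apply/eqmodP; rewrite reprK. Qed.

Definition preaddq x y : prefrac :=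
  (x.1 * sval y.2 + sval x.2 * y.1, mcM x.2 y.2).
Definition addq := lift_op2 total_quotient preaddq.

Lemma pi_addq : {morph \pi : x y / preaddq x y >-> addq x y}.
Proof.
move=> x y; unlock addq; apply/eqmodP => /=.
have /asboolP[t tP] := repr_frac_rel x; have /asboolP[u uP] := repr_frac_rel y.
move: (repr _) (repr _) => x' y' /= e2 e1.
apply/asboolP; exists (t * u); first exact: lregM.
rewrite /preaddq /= !(mulrDl, mulrDr).
transitivity (t * x.1 * sval x'.2 * (u * sval y.2 * sval y'.2) +
              u * y.1 * sval y'.2 * (t * sval x.2 * sval x'.2)); first by ring.
by rewrite e1 e2; ring.
Qed.
Canonical pi_add_morph := PiMorph2 pi_addq.

Definition premulq x y : prefrac := (x.1 * y.1, mcM x.2 y.2).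
Definition mulq := lift_op2 total_quotient premulq.

Lemma pi_mulq : {morph \pi : x y / premulq x y >-> mulq x y}.
Proof.
move=> x y; unlock mulq; apply/eqmodP => /=.
have /asboolP[t tP] := repr_frac_rel x; have /asboolP[u uP] := repr_frac_rel y.
move: (repr _) (repr _) => x' y' /= e2 e1.
apply/asboolP; exists (t * u); first exact: lregM.
rewrite /premulq /=.
transitivity (t * x.1 * sval x'.2 * (u * y.1 * sval y'.2)); first by ring.
by rewrite e1 e2; ring.
Qed.
Canonical pi_mul_morph := PiMorph2 pi_mulq.

Definition to_quotient :=
  lift_embed total_quotient (fun s => (s, mc1) : prefrac).
Canonical to_quotient_pi_morph := PiEmbed to_quotient.

Lemma eq_prefrac x y : x.1 * sval y.2 = sval x.2 * y.1 ->
  \pi_total_quotient x = \pi_total_quotient y.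
Proof.
move=> e; apply/eqmodP/asboolP; exists 1; first exact: lreg1.
by rewrite !mul1r.
Qed.

Lemma addqA : associative addq.
Proof.
elim/quotW=> x; elim/quotW=> y; elim/quotW=> z; rewrite !piE.
by apply: eq_prefrac => /=; ring.
Qed.

Lemma addqC : commutative addq.
Proof.
elim/quotW=> x; elim/quotW=> y; rewrite !piE.
by apply: eq_prefrac => /=; ring.
Qed.

Lemma addq0 : left_id (to_quotient 0) addq.
Proof.
by elim/quotW=> x; rewrite !piE; apply: eq_prefrac => /=; ring.
Qed.

HB.instance Definition _ := GRing.isNmodule.Build total_quotient addqA addqC addq0.

Lemma mulqA : associative mulq.
Proof.
elim/quotW=> x; elim/quotW=> y; elim/quotW=> z; rewrite !piE.
by apply: eq_prefrac => /=; ring.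
Qed.

Lemma mulqC : commutative mulq.
Proof.
elim/quotW=> x; elim/quotW=> y; rewrite !piE.
by apply: eq_prefrac => /=; ring.
Qed.

Lemma mulq1 : left_id (to_quotient 1) mulq.
Proof.
by elim/quotW=> x; rewrite !piE; apply: eq_prefrac => /=; ring.
Qed.

Lemma mulqDl : left_distributive mulq addq.
Proof.
elim/quotW=> x; elim/quotW=> y; elim/quotW=> z; rewrite !piE.
by apply: eq_prefrac => /=; ring.
Qed.

Lemma mulq0 : left_zero (to_quotient 0) mulq.
Proof.
by elim/quotW=> x; rewrite !piE; apply: eq_prefrac => /=; ring.
Qed.

Lemma oneq_neq0 : to_quotient 1 != to_quotient 0.
Proof.
apply/eqP; rewrite !piE => /eqmodP/asboolP[t tP /=].
by rewrite -!mulrA => /tP; rewrite !mulr1 mulr0 => /eqP; rewrite oner_eq0.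
Qed.

HB.instance Definition _ := GRing.Nmodule_isComNzSemiRing.Build total_quotient
  mulqA mulqC mulq1 mulqDl mulq0 oneq_neq0.

End TotalQuotient.

Section Ideals.
Variable S : comNzSemiRingType.
Implicit Types I J K : set S.

Definition semidomain : Prop := forall s : S, s != 0 -> GRing.lreg s.

Definition is_ideal I : Prop :=
  [/\ I !=set0, forall a b, I a -> I b -> I (a + b)
    & forall s a, I a -> I (s * a)].

Definition fin_gen I : Prop :=
  exists2 A : set S, finite_set A & I = smallest is_ideal A.

Definition ideal_add I J : set S := [set a + b | a in I & b in J].

Definition ideal_colon I J : set S := [set s | forall x, J x -> I (s * x)].

End Ideals.

(* Shared by ideals of S and fractional ideals, i.e. subsets of Q(S); all of  *)
(* these contain 0, so the empty sum n = 0 adds nothing.                      *)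
Definition ideal_mul (R : comNzSemiRingType) (I J : set R) : set R :=
  [set x | exists n (a b : 'I_n -> R),
    [/\ forall i, I (a i), forall i, J (b i) & x = \sum_(i < n) a i * b i]].

Section Invertible.
Variable S : comNzSemiRingType.
Implicit Types I J : set (total_quotient S).

Definition is_fractional_ideal I : Prop :=
  [/\ I !=set0, forall a b, I a -> I b -> I (a + b),
      forall (s : S) a, I a -> I (to_quotient s * a)
    & exists2 d : S, GRing.lreg d &
        forall a, I a -> range (@to_quotient S) (to_quotient d * a)].

Definition invertible I : Prop :=
  exists2 J, is_fractional_ideal J & ideal_mul I J = range (@to_quotient S).

End Invertible.

Definition prufer (S : comNzSemiRingType) : Prop :=
  forall I : set S, is_ideal I -> fin_gen I -> I <> [set 0] ->
    invertible (@to_quotient S @` I).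

(* Main.v *)
Require Import Defs.
From mathcomp Require Import all_boot all_algebra.
From mathcomp Require Import boolp classical_sets cardinality.
From mathcomp Require Import ring.

Set Implicit Arguments.
Unset Strict Implicit.
Unset Printing Implicit Defensive.

Import GRing.Theory.
Local Open Scope ring_scope.
Local Open Scope quotient_scope.
Local Open Scope classical_set_scope.

(** Everything goes through one elementary property of [S], called
    [locally_comparable] below: for all [a] and [b] there are [p + q = 1] such
    that [a] divides [p * b] and [b] divides [q * a].  It replaces the
    localizations of the classical proof over domains: on the piece of the
    unit given by [p] (resp. [q]) the ideal [(a, b)] is generated by [a]
    (resp. by [b]).

    Refining such splittings of [1] one generator at a time
    ([locally_principal]) shows that for every finite family [s] there are
    coefficients [p_c], [c] in [s], of sum [1] such that [c] divides
    [p_c * x] for all [x] in [s].  This uses no subtraction, and it yields: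
    - invertibility: the fractions [p_c / c] lie in the inverse of the ideal
      generated by [s], and [1] is the sum of the [c * (p_c / c)]
      ([locally_comparable_prufer]);
    - distributivity of products over intersections: [x] in [I J] and in
      [I K] only involves finitely many elements of [I], and each
      [p_c * x] is [c] times an element of [J], and [c] times an element of
      [K], which are equal as [c] is cancellable
      ([locally_comparable_mulI]);
    - [[I : J] + [J : I] = S], since each [p_c] carries the whole of [I + J]
      into the multiples of [c], hence into [I] or into [J]
      ([locally_comparable_colon]).
    Conversely local comparability of [a] and [b] comes back from the
    invertibility of [(a, b)], from the formula for
    [(I + J) (I `&` J)] at [I = (a)] and [J = (b)], and from
    [[I : J] + [J : I] = S] at the same ideals.  Finally the two formulas on
    colon ideals are equivalent to [[I : J] + [J : I] = S]: a splitting
    [1 = p + q] with [p] in [[I : J]] and [q] in [[J : I]] splits the elements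
    of [[I + J : K]] and of [[K : I `&` J]], and taking [K = I + J],
    resp. [K = I `&` J], makes the left-hand side contain [1]. *)

(** * Products of subsets of a semiring *)

Section Products.
Variable R : comNzSemiRingType.
Implicit Types I J T : set R.

Lemma ideal_mul_prod I J a b : I a -> J b -> ideal_mul I J (a * b).
Proof.
move=> Ia Jb; exists 1%N, (fun=> a), (fun=> b).
by split=> //; rewrite big_ord1.
Qed.

Lemma ideal_mul0 I J : ideal_mul I J 0.
Proof.
by exists 0%N, (fun=> 0), (fun=> 0); split; [case|case|rewrite big_ord0].
Qed.

Lemma ideal_mulD I J x y :
  ideal_mul I J x -> ideal_mul I J y -> ideal_mul I J (x + y).
Proof.
move=> [m [a [b [Ia Jb ->]]]] [n [c [d [Ic Jd ->]]]].
pose glue (f : 'I_m -> R) (g : 'I_n -> R) (i : 'I_(m + n)) :=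
  match split i with inl j => f j | inr j => g j end.
exists (m + n)%N, (glue a c), (glue b d); split.
- by move=> i; rewrite /glue; case: (split i).
- by move=> i; rewrite /glue; case: (split i).
rewrite big_split_ord; congr (_ + _); apply: eq_bigr => i _.
  by rewrite /glue (unsplitK (inl i)).
by rewrite /glue (unsplitK (inr i)).
Qed.

Lemma ideal_mul_sub I J T :
  T 0 -> (forall x y, T x -> T y -> T (x + y)) ->
  (forall a b, I a -> J b -> T (a * b)) -> ideal_mul I J `<=` T.
Proof.
move=> T0 TD TM x [n [a [b [Ia Jb ->]]]].
by apply: (big_ind T) => // i _; exact: TM.
Qed.

Lemma ideal_mulS I I' J J' :
  I `<=` I' -> J `<=` J' -> ideal_mul I J `<=` ideal_mul I' J'.
Proof.
move=> II' JJ'; apply: ideal_mul_sub; first exact: ideal_mul0.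
  exact: ideal_mulD.
by move=> a b /II' ? /JJ' ?; exact: ideal_mul_prod.
Qed.

Lemma ideal_mulC I J : ideal_mul I J = ideal_mul J I.
Proof.
suff sub I' J' : ideal_mul I' J' `<=` ideal_mul J' I'.
  by apply/seteqP; split; exact: sub.
apply: ideal_mul_sub; first exact: ideal_mul0.
  exact: ideal_mulD.
by move=> a b ? ?; rewrite mulrC; exact: ideal_mul_prod.
Qed.

End Products.

(** * Ideals *)

Section IdealTheory.
Variable S : comNzSemiRingType.
Implicit Types (I J K : set S) (a b c p q x y : S) (s : seq S).

Lemma idealD I a b : is_ideal I -> I a -> I b -> I (a + b).
Proof. by case=> _ + _; apply. Qed.

Lemma idealM I x a : is_ideal I -> I a -> I (x * a).
Proof. by case=> _ _; apply. Qed.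

Lemma ideal0 I : is_ideal I -> I 0.
Proof. by case=> -[a Ia] _ IM; rewrite -(mul0r a); exact: IM. Qed.

Lemma ideal_sum I (r : seq S) (F : S -> S) : is_ideal I ->
  (forall i, i \in r -> I (F i)) -> I (\sum_(i <- r) F i).
Proof.
move=> idI IF; rewrite big_seq; apply: (big_ind I) => //; first exact: ideal0.
by move=> x y; exact: idealD.
Qed.

Lemma ideal_addP I J : is_ideal I -> is_ideal J -> is_ideal (ideal_add I J).
Proof.
move=> idI idJ; split.
- exists (0 + 0), 0; first exact: ideal0.
  by exists 0 => //; exact: ideal0.
- move=> _ _ [a Ia [b Jb <-]] [c Ic [d Jd <-]].
  exists (a + c); first exact: idealD.
  by exists (b + d); [exact: idealD | rewrite addrACA].
- move=> t _ [a Ia [b Jb <-]]; exists (t * a); first exact: idealM.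
  by exists (t * b); [exact: idealM | rewrite mulrDr].
Qed.

Lemma ideal_addl I J : is_ideal J -> I `<=` ideal_add I J.
Proof.
by move=> idJ x Ix; exists x => //; exists 0; [exact: ideal0 | rewrite addr0].
Qed.

Lemma ideal_addr I J : is_ideal I -> J `<=` ideal_add I J.
Proof.
move=> idI x Jx; exists 0; first exact: ideal0.
by exists x => //; rewrite add0r.
Qed.

Lemma ideal_add_sub I J K : is_ideal K ->
  I `<=` K -> J `<=` K -> ideal_add I J `<=` K.
Proof.
by move=> idK IK JK _ [a /IK Ka [b /JK Kb <-]]; exact: idealD.
Qed.

Lemma ideal_capP I J : is_ideal I -> is_ideal J -> is_ideal (I `&` J).
Proof.
move=> idI idJ; split.
- by exists 0; split; exact: ideal0.
- by move=> a b [Ia Ja] [Ib Jb]; split; exact: idealD.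
- by move=> t a [Ia Ja]; split; exact: idealM.
Qed.

Lemma ideal_preim_mul I x : is_ideal I -> is_ideal [set y | I (x * y)].
Proof.
move=> idI; split.
- by exists 0; rewrite /= mulr0; exact: ideal0.
- by move=> a b /= Ia Ib; rewrite mulrDr; exact: idealD.
- by move=> t a /= Ia; rewrite mulrCA; exact: idealM.
Qed.

Lemma ideal_colonP I J : is_ideal I -> is_ideal (ideal_colon I J).
Proof.
move=> idI; split.
- by exists 0 => x _; rewrite mul0r; exact: ideal0.
- by move=> a b Ia Ib x Jx; rewrite mulrDl; apply: idealD; [|exact: Ia|exact: Ib].
- by move=> t a Ia x Jx; rewrite -mulrA; apply: idealM => //; exact: Ia.
Qed.

Lemma smallest_ideal (A : set S) : is_ideal (smallest (@is_ideal S) A).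
Proof.
split.
- by exists 0 => I [idI _]; exact: ideal0.
- by move=> a b Aa Ab I IA; apply: idealD; [case: IA|exact: Aa|exact: Ab].
- by move=> t a Aa I IA; apply: idealM; [case: IA|exact: Aa].
Qed.

Lemma smallest_mem s c : c \in s -> smallest (@is_ideal S) [set` s] c.
Proof. by move=> cs; apply: sub_gen_smallest. Qed.

Definition principal a : set S := [set x | exists r, x = r * a].

Lemma principal_ideal a : is_ideal (principal a).
Proof.
split.
- by exists 0, 0; rewrite mul0r.
- by move=> _ _ [r ->] [t ->]; exists (r + t); rewrite mulrDl.
- by move=> x _ [r ->]; exists (x * r); rewrite mulrA.
Qed.

Lemma principal_id a : principal a a.
Proof. by exists 1; rewrite mul1r. Qed.

Lemma principal_sub I a : is_ideal I -> I a -> principal a `<=` I.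
Proof. by move=> idI Ia _ [r ->]; exact: idealM. Qed.

Lemma fin_gen_principal a : fin_gen (principal a).
Proof.
exists [set a]; first exact: finite_set1.
apply/seteqP; split.
  apply: principal_sub; first exact: smallest_ideal.
  exact: sub_gen_smallest.
apply: smallest_sub; first exact: principal_ideal.
by move=> _ ->; exact: principal_id.
Qed.

Lemma smallest_setU (A B : set S) : smallest (@is_ideal S) (A `|` B) =
  ideal_add (smallest (@is_ideal S) A) (smallest (@is_ideal S) B).
Proof.
have idA := smallest_ideal A; have idB := smallest_ideal B.
apply/seteqP; split.
  apply: smallest_sub; first exact: ideal_addP.
  move=> x [Ax|Bx]; [apply: ideal_addl|apply: ideal_addr] => //;
    exact: sub_gen_smallest.
apply: ideal_add_sub; first exact: smallest_ideal.
  apply: smallest_sub; first exact: smallest_ideal.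
  by move=> x Ax; apply: sub_gen_smallest; left.
apply: smallest_sub; first exact: smallest_ideal.
by move=> x Bx; apply: sub_gen_smallest; right.
Qed.

Lemma fin_gen_add I J : fin_gen I -> fin_gen J -> fin_gen (ideal_add I J).
Proof.
move=> [A finA ->] [B finB ->]; exists (A `|` B); first by rewrite finite_setU.
by rewrite smallest_setU.
Qed.

(** A generating list containing [0] is never empty, so that the zero ideal
    needs no separate treatment in the applications of [locally_principal]. *)
Lemma fin_gen_seq I : fin_gen I ->
  exists2 s : seq S, 0 \in s & I = smallest (@is_ideal S) [set` s].
Proof.
case=> A /finite_seqP[s ->] ->; exists (0 :: s); first exact: mem_head.
apply/seteqP; split; apply: smallest_sub; try exact: smallest_ideal.
  by move=> x xs; apply: sub_gen_smallest => /=; rewrite inE xs orbT.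
move=> x /=; rewrite inE => /predU1P[->|xs]; last exact: sub_gen_smallest.
exact: ideal0 (smallest_ideal _).
Qed.

Lemma colon_addT I J : is_ideal I -> is_ideal J ->
  (ideal_add (ideal_colon I J) (ideal_colon J I) = setT) <->
  (exists p q, [/\ p + q = 1, ideal_colon I J p & ideal_colon J I q]).
Proof.
move=> idI idJ; split=> [eT|[p [q [pq Ip Jq]]]].
  have : ideal_add (ideal_colon I J) (ideal_colon J I) 1 by rewrite eT.
  by move=> [p Ip [q Jq pq]]; exists p, q.
have idC := ideal_addP (ideal_colonP J idI) (ideal_colonP I idJ).
apply/seteqP; split=> // x _; rewrite -(mulr1 x); apply: idealM => //.
by rewrite -pq; exists p => //; exists q.
Qed.

(** * Local comparability *)

(** Over a domain this says that every localization at a maximal ideal is a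
    valuation ring: at each maximal ideal [p] or [q] is a unit. *)
Definition locally_comparable : Prop := forall a b,
  exists p q, [/\ p + q = 1, principal a (p * b) & principal b (q * a)].

(** Induction on [s].  To add [b], split each [p_c] along the splitting
    [1 = u_c + v_c] comparing [b] to [c]: the part [p_c * u_c] stays with [c],
    which then also divides [b], and the parts [p_c * v_c] are given to [b],
    which divides them times [x] since [c] divides [p_c * x]. *)
Lemma locally_principal s : locally_comparable -> uniq s -> s != [::] ->
  exists2 p : S -> S, \sum_(c <- s) p c = 1 &
    forall c x, c \in s -> x \in s -> principal c (p c * x).
Proof.
move=> cmp; elim: s => // b [|d s] IHs.
  move=> _ _; exists (fun=> 1); first by rewrite big_seq1.
  by move=> c x; rewrite !inE => /eqP-> /eqP->; rewrite mul1r; exact: principal_id.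
rewrite cons_uniq => /andP[bs us] _.
move: (d :: s) IHs bs us (erefl : d :: s != [::]).
move=> {d}{}s IHs bs us s0; have [p p1 pP] := IHs us s0.
have /choice[uv uvP] c : exists uv : S * S,
    [/\ uv.1 + uv.2 = 1, principal c (uv.1 * b) & principal b (uv.2 * c)].
  by have [u [v uvP]] := cmp c b; exists (u, v).
pose p' c := if c == b then \sum_(d <- s) p d * (uv d).2 else p c * (uv c).1.
have p'E c : c \in s -> p' c = p c * (uv c).1.
  by rewrite /p'; case: eqP => // -> bs'; rewrite bs' in bs.
have p'b : p' b = \sum_(d <- s) p d * (uv d).2 by rewrite /p' eqxx.
exists p'.
  rewrite big_cons p'b [X in _ + X](eq_big_seq _ p'E) -big_split -p1 /=.
  by apply: eq_bigr => c _; have [uv1 _ _] := uvP c; rewrite -mulrDr addrC uv1 mulr1.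
move=> c x; rewrite !inE => /predU1P[->|cs].
  move=> /predU1P[->|xs]; first by exists (p' b).
  rewrite p'b big_distrl /=; apply: ideal_sum; first exact: principal_ideal.
  move=> d ds; have [r rE] := pP d x ds xs; have [_ _ bd] := uvP d.
  rewrite mulrAC rE -mulrA [d * _]mulrC; apply: idealM => //.
  exact: principal_ideal.
rewrite p'E //; have [_ cb _] := uvP c; case/predU1P=> [->|xs].
  by rewrite -mulrA; apply: idealM => //; exact: principal_ideal.
rewrite mulrAC mulrC; apply: idealM; first exact: principal_ideal.
exact: pP.
Qed.

(** Being carried into the multiples of [c] passes from the generators to the
    ideal that they generate. *)
Lemma locally_principal_ideal s : locally_comparable -> uniq s -> s != [::] ->
  exists2 p : S -> S, \sum_(c <- s) p c = 1 &
    forall c x, c \in s -> smallest (@is_ideal S) [set` s] x -> principal c (p c * x).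
Proof.
move=> cmp us s0; have [p p1 pP] := locally_principal cmp us s0.
exists p => // c x cs.
apply: (@smallest_sub _ _ [set` s] [set y | principal c (p c * y)]).
  exact/ideal_preim_mul/principal_ideal.
by move=> y /= ys; exact: pP.
Qed.

Lemma locally_comparable_colon I J : locally_comparable ->
  fin_gen I -> fin_gen J ->
  ideal_add (ideal_colon I J) (ideal_colon J I) = setT.
Proof.
move=> cmp /fin_gen_seq[s s0 ->] /fin_gen_seq[t _ ->].
have idI := smallest_ideal [set` s]; have idJ := smallest_ideal [set` t].
have [||p p1 pP] := @locally_principal_ideal (undup (s ++ t)) cmp.
- exact: undup_uniq.
- apply/eqP => st; have : 0 \in undup (s ++ t) by rewrite mem_undup mem_cat s0.
  by rewrite st.
have stE : [set` undup (s ++ t)] = [set` s] `|` [set` t].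
  apply/seteqP; split=> x /=; rewrite mem_undup mem_cat; first by move/orP.
  by move=> ?; apply/orP.
rewrite stE smallest_setU in pP.
have idC := ideal_addP (ideal_colonP (smallest (@is_ideal S) [set` t]) idI)
                       (ideal_colonP (smallest (@is_ideal S) [set` s]) idJ).
apply/seteqP; split=> // x _; rewrite -(mulr1 x); apply: idealM => //.
rewrite -p1; apply: ideal_sum => // c cst.
have /orP[cs|ct] : (c \in s) || (c \in t) by rewrite -mem_cat -mem_undup.
- apply: ideal_addl; first exact: ideal_colonP.
  move=> y Jy; apply: (principal_sub idI (smallest_mem cs)).
  by apply: pP => //; exact: ideal_addr.
- apply: ideal_addr; first exact: ideal_colonP.
  move=> y Iy; apply: (principal_sub idJ (smallest_mem ct)).
  by apply: pP => //; exact: ideal_addl.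
Qed.

Lemma colon_locally_comparable :
  (forall I J, is_ideal I -> is_ideal J -> fin_gen I -> fin_gen J ->
     ideal_add (ideal_colon I J) (ideal_colon J I) = setT) ->
  locally_comparable.
Proof.
move=> h a b; have ida := principal_ideal a; have idb := principal_ideal b.
have /(colon_addT ida idb)[p [q [pq pa qb]]] :=
  h _ _ ida idb (fin_gen_principal a) (fin_gen_principal b).
by exists p, q; split=> //; [apply: pa|apply: qb]; exact: principal_id.
Qed.

(** * Products and intersections *)

(** [I] need not be finitely generated: the splitting of [1] is adapted to the
    finitely many elements [a i], [c i] of [I] in two expressions of a given
    [x], one in [I J] and one in [I K]. *)
Lemma locally_comparable_mulI I J K : semidomain S -> locally_comparable ->
  is_ideal I -> is_ideal J -> is_ideal K ->
  ideal_mul I (J `&` K) = ideal_mul I J `&` ideal_mul I K.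
Proof.
move=> hS cmp idI idJ idK; apply/seteqP; split=> [x IJK|x].
  by split; apply: ideal_mulS IJK => // y [].
move=> [[m [a [b [Ia Jb xab]]]] [n [c [d [Ic Kd xcd]]]]].
pose s : seq S := undup (0 :: codom a ++ codom c).
have as_ i : a i \in s by rewrite mem_undup inE mem_cat codom_f orbT.
have cs_ i : c i \in s by rewrite mem_undup inE mem_cat codom_f !orbT.
have sI (e : S) : e \in s -> I e.
  rewrite mem_undup inE mem_cat => /predU1P[->|/orP[]/codomP[i ->]] //.
  exact: ideal0.
have [||p p1 pP] := @locally_principal s cmp; first exact: undup_uniq.
  apply/eqP => s0; have : 0 \in s by rewrite mem_undup mem_head.
  by rewrite s0.
(* Since e divides every p_e * f_i, multiplying by p_e turns the sum into a
   single product of e by an element of L. *)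
have div L k (f g : 'I_k -> S) (e : S) : is_ideal L -> e \in s ->
    (forall i, f i \in s) -> (forall i, L (g i)) ->
    exists2 y, L y & p e * (\sum_(i < k) f i * g i) = e * y.
  move=> idL es fs Lg.
  have /choice[u uP] i : exists r, p e * f i = r * e by exact: pP.
  exists (\sum_(i < k) u i * g i).
    apply: (big_ind L); first exact: ideal0.
      by move=> y z; exact: idealD.
    by move=> i _; exact: idealM.
  by rewrite !big_distrr; apply: eq_bigr => i _ /=; rewrite !mulrA uP [u i * e]mulrC.
rewrite -(mul1r x) -p1 big_distrl /= big_seq.
apply: (big_ind (ideal_mul I (J `&` K))); first exact: ideal_mul0.
  by move=> y z; exact: ideal_mulD.
move=> e es; have [y Jy] := div J _ a b e idJ es as_ Jb; rewrite -xab => xy.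
have [z Kz] := div K _ c d e idK es cs_ Kd; rewrite -xcd xy => yz.
case: (eqVneq e 0) => [->|e0]; first by rewrite mul0r; exact: ideal_mul0.
apply: ideal_mul_prod; first exact: sI.
by split=> //; rewrite (hS _ e0 _ _ yz).
Qed.

(** [(I + J) (I `&` J)] always lies in [I J], and [I J] lies in both
    [(I + J) I] and [(I + J) J]. *)
Lemma mulI_add_cap I J : is_ideal I -> is_ideal J ->
  ideal_mul (ideal_add I J) (I `&` J) =
    ideal_mul (ideal_add I J) I `&` ideal_mul (ideal_add I J) J ->
  ideal_mul (ideal_add I J) (I `&` J) = ideal_mul I J.
Proof.
move=> idI idJ eIJ; apply/seteqP; split.
  apply: ideal_mul_sub; [exact: ideal_mul0|exact: ideal_mulD|].
  move=> _ x [a Ia [b Jb <-]] [Ix Jx]; rewrite mulrDl; apply: ideal_mulD.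
    exact: ideal_mul_prod.
  by rewrite mulrC; exact: ideal_mul_prod.
rewrite eIJ => x IJx; split; last exact: ideal_mulS (ideal_addl idJ) _ _ IJx.
by rewrite ideal_mulC in IJx; exact: ideal_mulS (ideal_addr idI) _ _ IJx.
Qed.

(** For [I = (a)] and [J = (b)] the element [a * b] of [I J] is
    [a * c + b * d] with [c] and [d] in both ideals.  Writing [c = p * b] and
    [d = q * a] and cancelling [a * b] leaves [1 = p + q]. *)
Lemma add_cap_locally_comparable : semidomain S ->
  (forall I J, is_ideal I -> is_ideal J ->
     ideal_mul (ideal_add I J) (I `&` J) = ideal_mul I J) ->
  locally_comparable.
Proof.
move=> hS h a b; have ida := principal_ideal a; have idb := principal_ideal b.
have [->|a0] := eqVneq a 0.
  exists 0, 1; rewrite add0r mul0r mulr0; split=> //; exact: ideal0 (principal_ideal _).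
have [->|b0] := eqVneq b 0.
  exists 1, 0; rewrite addr0 mul0r mulr0; split=> //; exact: ideal0 (principal_ideal _).
have : ideal_mul (principal a) (principal b) (a * b).
  by apply: ideal_mul_prod; exact: principal_id.
rewrite -h // => abE.
pose T := [set z | exists c d, [/\ (principal a `&` principal b) c,
  (principal a `&` principal b) d & z = a * c + b * d]].
have idc := ideal_capP ida idb.
have : T (a * b).
  apply: ideal_mul_sub abE.
  - exists 0, 0; split; [exact: ideal0|exact: ideal0|by rewrite !mulr0 addr0].
  - move=> _ _ [c [d [Ic Id ->]]] [c' [d' [Ic' Id' ->]]].
    exists (c + c'), (d + d'); split; [exact: idealD|exact: idealD|].
    by rewrite !mulrDr addrACA.
  - move=> _ z [_ [r ->] [_ [t ->] <-]] Iz; exists (r * z), (t * z).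
    by split; [exact: idealM|exact: idealM|ring].
move=> [c [d [[ac [p cE]] [[q dE] bd] abpq]]]; exists p, q.
rewrite -cE -dE; split=> //.
have ab0 : GRing.lreg (a * b) by apply: lregM; exact: hS.
by apply: ab0; rewrite mulr1 [RHS]abpq cE dE; ring.
Qed.

(** * Colon ideals *)

(** For [x] in [[(I + J) : K]], the elements [x * k], [k] a generator of [K],
    only involve finitely generated ideals [I0] and [J0] inside [I] and [J];
    the splitting of [1] comes from [[I0 : J0] + [J0 : I0] = S]. *)
Lemma colon_addl I J K :
  (forall I J, is_ideal I -> is_ideal J -> fin_gen I -> fin_gen J ->
     ideal_add (ideal_colon I J) (ideal_colon J I) = setT) ->
  is_ideal I -> is_ideal J -> fin_gen K ->
  ideal_colon (ideal_add I J) K = ideal_add (ideal_colon I K) (ideal_colon J K).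
Proof.
move=> h idI idJ [A finA ->]; set K' := smallest _ _.
apply/seteqP; split=> [x xK|]; last first.
  apply: ideal_add_sub; first exact/ideal_colonP/ideal_addP.
    by move=> x xI k Kk; apply: ideal_addl => //; exact: xI.
  by move=> x xJ k Kk; apply: ideal_addr => //; exact: xJ.
have /choice[ab abP] k : exists ab : S * S,
    A k -> [/\ I ab.1, J ab.2 & x * k = ab.1 + ab.2].
  have [Ak|nAk] := pselect (A k); last by exists (0, 0).
  have [a Ia [b Jb abE]] := xK k (sub_gen_smallest Ak).
  by exists (a, b).
pose A1 := [set (ab k).1 | k in A]; pose A2 := [set (ab k).2 | k in A].
pose I0 := smallest (@is_ideal S) A1; pose J0 := smallest (@is_ideal S) A2.
have I0I : I0 `<=` I.
  by apply: smallest_sub => // _ [k Ak <-]; have [] := abP k Ak.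
have J0J : J0 `<=` J.
  by apply: smallest_sub => // _ [k Ak <-]; have [] := abP k Ak.
have idI0 : is_ideal I0 := @smallest_ideal _.
have idJ0 : is_ideal J0 := @smallest_ideal _.
have xIJ : K' `<=` [set k | ideal_add I0 J0 (x * k)].
  apply: smallest_sub; first exact/ideal_preim_mul/ideal_addP.
  move=> k Ak /=; have [_ _ ->] := abP k Ak.
  by exists (ab k).1; last exists (ab k).2 => //; exact: sub_gen_smallest (imageP _ Ak).
have := h I0 J0 idI0 idJ0; case/(_ _ _)/(colon_addT idI0 idJ0).
- by exists A1 => //; exact: finite_image.
- by exists A2 => //; exact: finite_image.
move=> p [q [pq pI qJ]]; rewrite -(mul1r x) -pq mulrDl.
exists (p * x).
  move=> k /xIJ[a I0a [b J0b abE]]; apply: I0I; rewrite -mulrA -abE mulrDr.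
  by apply: (idealD idI0); [exact: (idealM _ idI0)|exact: pI].
exists (q * x) => // k /xIJ[a I0a [b J0b abE]]; apply: J0J.
rewrite -mulrA -abE mulrDr.
by apply: (idealD idJ0); [exact: qJ|exact: (idealM _ idJ0)].
Qed.

Lemma colon_add_self I J : is_ideal I -> is_ideal J ->
  ideal_colon (ideal_add I J) (ideal_add I J) =
    ideal_add (ideal_colon I (ideal_add I J)) (ideal_colon J (ideal_add I J)) ->
  ideal_add (ideal_colon I J) (ideal_colon J I) = setT.
Proof.
move=> idI idJ e; apply/colon_addT => //.
have : ideal_colon (ideal_add I J) (ideal_add I J) 1 by move=> x; rewrite mul1r.
rewrite e => -[p pI [q qJ pq]]; exists p, q; split=> // x ?.
  by apply: pI; exact: ideal_addr.
by apply: qJ; exact: ideal_addl.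
Qed.

Lemma colon_cap I J K : is_ideal I -> is_ideal J -> is_ideal K ->
  ideal_add (ideal_colon I J) (ideal_colon J I) = setT ->
  ideal_colon K (I `&` J) = ideal_add (ideal_colon K I) (ideal_colon K J).
Proof.
move=> idI idJ idK /(colon_addT idI idJ)[p [q [pq pI qJ]]].
apply/seteqP; split=> [x xK|]; last first.
  apply: ideal_add_sub; first exact: ideal_colonP.
    by move=> x xK y [Iy _]; exact: xK.
  by move=> x xK y [_ Jy]; exact: xK.
exists (x * q).
  by move=> y Iy; rewrite -mulrA; apply: xK; split; [exact: idealM|exact: qJ].
exists (x * p); last by rewrite -mulrDr addrC pq mulr1.
by move=> y Jy; rewrite -mulrA; apply: xK; split; [exact: pI|exact: idealM].
Qed.

Lemma colon_cap_self I J : is_ideal I -> is_ideal J ->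
  ideal_colon (I `&` J) (I `&` J) =
    ideal_add (ideal_colon (I `&` J) I) (ideal_colon (I `&` J) J) ->
  ideal_add (ideal_colon I J) (ideal_colon J I) = setT.
Proof.
move=> idI idJ e; apply/colon_addT => //.
have : ideal_colon (I `&` J) (I `&` J) 1 by move=> x; rewrite mul1r.
rewrite e => -[q qJ [p pI pq]]; exists p, q; rewrite addrC; split=> // x ?.
  by have [] := pI x.
by have [] := qJ x.
Qed.

(** * Invertible ideals *)

Local Notation tq := (@to_quotient S).
Local Notation tq_range := (range tq).

Lemma to_quotientD a b : tq (a + b) = tq a + tq b.
Proof. by rewrite [RHS]/GRing.add /= !piE; apply: eq_prefrac => /=; ring. Qed.

Lemma to_quotientM a b : tq (a * b) = tq a * tq b.
Proof. by rewrite [RHS]/GRing.mul /= !piE; apply: eq_prefrac => /=; ring. Qed.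

Lemma to_quotient0 : tq 0 = 0. Proof. by []. Qed.

Lemma to_quotient1 : tq 1 = 1. Proof. by []. Qed.

Lemma to_quotient_inj : injective tq.
Proof.
move=> a b; rewrite !piE => /eqmodP/asboolP[t tP /=].
by rewrite !mulr1 => /tP.
Qed.

Lemma to_quotient_div a b : GRing.lreg b -> exists z, tq b * z = tq a.
Proof.
move=> regb.
pose d : mc S := exist (fun t => `[< GRing.lreg t >]) b (asboolT regb).
exists (\pi_(total_quotient S) (a, d)).
by rewrite [LHS]/GRing.mul /= !piE; apply: eq_prefrac => /=; ring.
Qed.

(** If [1 = a y + b z] with [y], [z] in an inverse of [(a, b)], then
    [p = a y] and [q = b z] are in [S], and so are [u = b y] and [v = a z],
    which witness [p b = u a] and [q a = v b]. *)
Lemma prufer_locally_comparable : prufer S -> locally_comparable.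
Proof.
move=> pruS a b; have [->|a0] := eqVneq a 0.
  exists 0, 1; rewrite add0r mul0r mulr0; split=> //; exact: ideal0 (principal_ideal _).
have ida := principal_ideal a; have idb := principal_ideal b.
pose I := ideal_add (principal a) (principal b).
have Ia : I a by apply: ideal_addl => //; exact: principal_id.
have Ib : I b by apply: ideal_addr => //; exact: principal_id.
have I0 : I <> [set 0] by move=> e; move: Ia a0; rewrite e /= => ->; rewrite eqxx.
have [J [[z0 Jz0] JD JM _] IJ] := pruS I (ideal_addP ida idb)
  (fin_gen_add (fin_gen_principal a) (fin_gen_principal b)) I0.
have IJ_range x z : I x -> J z -> tq_range (tq x * z).
  by move=> Ix Jz; rewrite -IJ; apply: ideal_mul_prod => //; exists x.
pose T := [set w | exists y z : total_quotient S, [/\ J y, J z & w = tq a * y + tq b * z]].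
have : T 1.
  have : tq_range 1 by exists 1.
  rewrite -IJ; apply: ideal_mul_sub.
  - have J0 : J 0 by rewrite -(mul0r z0) -to_quotient0; exact: JM.
    by exists 0, 0; rewrite !mulr0 addr0.
  - move=> _ _ [y [z [Jy Jz ->]]] [y' [z' [Jy' Jz' ->]]].
    exists (y + y'), (z + z'); split; [exact: JD|exact: JD|].
    by rewrite !mulrDr addrACA.
  - move=> _ w [_ [_ [r ->] [_ [t ->] <-]] <-] Jw.
    exists (tq r * w), (tq t * w); split; [exact: JM|exact: JM|].
    by rewrite to_quotientD !to_quotientM; ring.
move=> [y [z [Jy Jz e1]]].
have [p _ pE] := IJ_range a y Ia Jy; have [q _ qE] := IJ_range b z Ib Jz.
have [u _ uE] := IJ_range b y Ib Jy; have [v _ vE] := IJ_range a z Ia Jz.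
exists p, q; split.
- by apply: to_quotient_inj; rewrite to_quotientD pE qE -e1.
- by exists u; apply: to_quotient_inj; rewrite !to_quotientM pE uE; ring.
- by exists v; apply: to_quotient_inj; rewrite !to_quotientM qE vE; ring.
Qed.

(** The inverse is taken to be the set of all [z] with [z I] inside [S].  It
    contains [p_c / c] for each nonzero generator [c], because [c] divides
    [p_c * x] for every [x] in [I]. *)
Lemma locally_comparable_prufer :
  semidomain S -> locally_comparable -> prufer S.
Proof.
move=> hS cmp I idI /fin_gen_seq[s s0 IE] I0.
have [||p p1] := @locally_principal_ideal (undup s) cmp; first exact: undup_uniq.
  apply/eqP => e; have : 0 \in undup s by rewrite mem_undup.
  by rewrite e.
have -> : [set` undup s] = [set` s].
  by apply/seteqP; split=> x /=; rewrite mem_undup.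
rewrite -IE => pP.
have [d Id d0] : exists2 d, I d & d != 0.
  apply: contrapT => nd; apply: I0; apply/seteqP; split=> [x Ix|_ ->].
    by apply: contrapT => /eqP x0; apply: nd; exists x.
  exact: ideal0.
pose J := [set z | forall x, I x -> tq_range (tq x * z)].
have rangeD w z : tq_range w -> tq_range z -> tq_range (w + z).
  by move=> [a _ <-] [b _ <-]; exists (a + b) => //; rewrite to_quotientD.
have range0 : tq_range 0 by exists 0.
exists J.
  split.
  - by exists 0 => x _; rewrite mulr0.
  - by move=> y z Jy Jz x Ix; rewrite mulrDr; apply: rangeD; [exact: Jy|exact: Jz].
  - move=> t z Jz x Ix; have [r _ rE] := Jz x Ix.
    by exists (t * r) => //; rewrite to_quotientM rE mulrCA.
  - by exists d; [exact: hS|move=> z; exact].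
apply/seteqP; split.
  by apply: ideal_mul_sub => // _ z [x Ix <-] Jz; exact: Jz.
move=> _ [t _ <-]; rewrite -(mulr1 t) -p1 big_distrr /= big_seq.
apply: (big_ind (fun x => ideal_mul (tq @` I) J (tq x))).
- exact: ideal_mul0.
- by move=> x y; rewrite to_quotientD; exact: ideal_mulD.
move=> c cs; have [c0|c0] := eqVneq c 0.
  (* The generator 0 carries no part of the unit: p_0 kills the nonzero d. *)
  have [r] := pP c d cs Id; rewrite c0 mulr0 => pd.
  have -> : p 0 = 0 by apply: (hS d d0); rewrite mulr0 mulrC.
  by rewrite mulr0; exact: ideal_mul0.
have [z zE] := to_quotient_div (t * p c) (hS c c0).
rewrite -zE; apply: ideal_mul_prod.
  by exists c => //; rewrite IE; apply: sub_gen_smallest; rewrite /= -mem_undup.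
move=> x Ix; have [r rE] := pP c x cs Ix; exists (t * r) => //.
have [w wE] := to_quotient_div 1 (hS c c0).
rewrite -[LHS]mul1r -[RHS]mul1r -to_quotient1 -wE.
transitivity (w * (tq x * (tq c * z))); last by ring.
rewrite zE -!to_quotientM (_ : x * (t * p c) = t * (p c * x)); last by ring.
by rewrite rE !to_quotientM; ring.
Qed.

End IdealTheory.

(** * Characterizations of Pruefer semidomains *)

Theorem theorem3p9 (S : comNzSemiRingType) (hS : semidomain S) :
  [<-> prufer S;
       forall I J K : set S, is_ideal I -> is_ideal J -> is_ideal K ->
         ideal_mul I (J `&` K) = ideal_mul I J `&` ideal_mul I K;
       forall I J : set S, is_ideal I -> is_ideal J ->
         ideal_mul (ideal_add I J) (I `&` J) = ideal_mul I J;
       forall I J K : set S, is_ideal I -> is_ideal J -> is_ideal K ->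
         fin_gen K ->
         ideal_colon (ideal_add I J) K
           = ideal_add (ideal_colon I K) (ideal_colon J K);
       forall I J : set S, is_ideal I -> is_ideal J ->
         fin_gen I -> fin_gen J ->
         ideal_add (ideal_colon I J) (ideal_colon J I) = setT;
       forall I J K : set S, is_ideal I -> is_ideal J -> is_ideal K ->
         fin_gen I -> fin_gen J ->
         ideal_colon K (I `&` J)
           = ideal_add (ideal_colon K I) (ideal_colon K J)].
Proof.
tfae.
- move=> /prufer_locally_comparable cmp I J K; exact: locally_comparable_mulI.
- move=> h I J idI idJ; apply: mulI_add_cap => //.
  by apply: h => //; exact: ideal_addP.
- move=> /(add_cap_locally_comparable hS) cmp I J K idI idJ _ fK.
  by apply: colon_addl => // *; exact: locally_comparable_colon.
- move=> h I J idI idJ fI fJ; apply: colon_add_self => //.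
  by apply: h => //; [exact: ideal_addP|exact: fin_gen_add].
- by move=> h I J K idI idJ idK fI fJ; apply: colon_cap => //; exact: h.
- move=> h; apply: locally_comparable_prufer => //.
  apply: colon_locally_comparable => I J idI idJ fI fJ.
  by apply: colon_cap_self => //; apply: h => //; exact: ideal_capP.
Qed.
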